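(* Let $n \ge 1$ and let $\tilde{\mathcal{Q}}_{n+1}$ denote the reduced signless Laplacian of the complete graph $K_{n+1}$. Then the number of standard monomials of $M_n^{(1)}$ equals the determinant of $\tilde{\mathcal{Q}}_{n+1}$, and this number is \[|\operatorname{stan}_n^1| = \det \tilde{\mathcal{Q}}_{n+1} = (2n-1)(n-1)^{n-1}.\]
   Context: Fix a field $\mathbb{K}$ and let $S = \mathbb{K}[x_1,\dots,x_n]$, $[n]=\{1,\dots,n\}$. For nonempty $\sigma \subseteq [n]$ let $m_\sigma = \prod_{i\in\sigma} x_i^{\,n-|\sigma|+1}$. Let $M_n^{(1)} = \langle m_\sigma : \sigma \subseteq [n],\ 1 \le |\sigma| \le 2\rangle \subset S$. The standard monomials of a monomial ideal are the monomials of $S$ not lying in the ideal; $\operatorname{stan}_n^1$ denotes the set of standard monomials of $M_n^{(1)}$. For a graph $G$ on vertex set $\{0,1,\dots,n\}$, the signless Laplacian $\mathcal{Q}(G)$ is the symmetric $(n+1)\times(n+1)$ matrix indexed by the vertices with $\mathcal{Q}_{i,i} = \deg(i)$ and, for $i\ne j$, $\mathcal{Q}_{i,j}$ equal to the number of edges connecting $i$ and $j$. The reduced signless Laplacian $\tilde{\mathcal{Q}}(G)$ is obtained from $\mathcal{Q}(G)$ by deleting the row and column indexed by the vertex $0$. $K_{n+1}$ is the complete graph on $\{0,1,\dots,n\}$. The convention $0^0=1$ is used when $n=1$. *)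

(* Defs.v *)
From mathcomp Require Import all_boot all_order all_algebra.
From mathcomp Require Import finmap mpoly.
Set Implicit Arguments.
Unset Strict Implicit.
Unset Printing Implicit Defensive.
Import GRing.Theory.
Local Open Scope ring_scope.

Definition ideal_gen (R : comNzRingType) (I : finType) (P : pred I)
    (g : I -> R) (f : R) : Prop :=
  exists c : I -> R, f = \sum_(i | P i) c i * g i.

(* The variables x_1, ..., x_n are indexed by 'I_n.  The subtraction
   n - #|s| is never truncated since #|s| <= n. *)
Definition m_sigma (K : fieldType) (n : nat) (s : {set 'I_n}) : {mpoly K[n]} :=
  \prod_(i in s) 'X_i ^+ (n - #|s| + 1).

Definition in_M1 (K : fieldType) (n : nat) (f : {mpoly K[n]}) : Prop :=
  ideal_gen (fun s : {set 'I_n} => (1 <= #|s| <= 2)%N) (@m_sigma K n) f.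

(* Monomials are represented by their exponent vectors. *)
Definition standard_monomial (K : fieldType) (n : nat) (m : 'X_{1..n}) : Prop :=
  ~ in_M1 ('X_[m] : {mpoly K[n]}).

(* Loopless multigraphs on {0, ..., n}: [edges i j] is the number of edges
   connecting i and j. *)
Record graph (n : nat) := Graph {
  edges :> 'I_n.+1 -> 'I_n.+1 -> nat;
  edges_sym : forall i j, edges i j = edges j i;
  edges_irr : forall i, edges i i = 0%N
}.

Definition deg (n : nat) (G : graph n) (i : 'I_n.+1) : nat :=
  (\sum_j G i j)%N.

Definition signless_laplacian (n : nat) (G : graph n) : 'M[int]_n.+1 :=
  \matrix_(i, j) (if i == j then deg G i else G i j)%:Z.

Definition reduced_signless_laplacian (n : nat) (G : graph n) : 'M[int]_n :=
  row' ord0 (col' ord0 (signless_laplacian G)).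

Definition complete_edges (n : nat) (i j : 'I_n.+1) : nat := (i != j).

Lemma complete_edges_sym (n : nat) (i j : 'I_n.+1) :
  complete_edges i j = complete_edges j i.
Proof. by rewrite /complete_edges eq_sym. Qed.

Lemma complete_edges_irr (n : nat) (i : 'I_n.+1) : complete_edges i i = 0%N.
Proof. by rewrite /complete_edges eqxx. Qed.

(* [complete_graph n] is K_{n+1}, on the n+1 vertices {0, ..., n}. *)
Definition complete_graph (n : nat) : graph n :=
  Graph (@complete_edges_sym n) (@complete_edges_irr n).

(* Main.v *)
(** The exponents of the generators of [M_n^(1)] show that [x^m] is standard
    iff every [m i] is at most [n - 1], with equality for at most one [i].
    Counting by the position of that coordinate, if any, gives
    [(n-1)^n + n (n-1)^(n-1)].  On the other side the reduced signless Laplacian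
    is [(n-1) I + J], with [J] the all-ones matrix. *)
Require Import Defs.
From mathcomp Require Import all_boot all_order all_algebra.
From mathcomp Require Import finmap mpoly ring.
Set Implicit Arguments.
Unset Strict Implicit.
Unset Printing Implicit Defensive.
Import GRing.Theory.
Local Open Scope ring_scope.

(** The all-ones vector is an eigenvector for [a + m.+1%:R], and [a] accounts for the other [m]
    dimensions. The size is written [1 + m] so that the first row and column split off as blocks. *)
Lemma det_scalar_add_const1 (R : comNzRingType) (m : nat) (a : R) :
  \det (a%:M + const_mx 1 : 'M[R]_(1 + m)) = (a + m.+1%:R) * a ^+ m.
Proof.
set A := (X in \det X).
(* Conjugation by [1 0; -1 I] makes the matrix block upper triangular. *)
pose L (e : R) : 'M[R]_(1 + m) := block_mx 1%:M 0 (const_mx e) 1%:M.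
have detL e : \det (L e) = 1 by rewrite det_lblock !det1 mulr1.
have LAL : L (- 1) *m A *m L 1 =
    block_mx (a + m.+1%:R)%:M (const_mx 1) 0 a%:M.
  have -> : A = block_mx (a + 1)%:M (const_mx 1) (const_mx 1)
                  (a%:M + const_mx 1).
    apply/matrixP => i j; rewrite -(splitK i) -(splitK j).
    case: (split i) => i'; case: (split j) => j' /=;
      rewrite ?block_mxEul ?block_mxEur ?block_mxEdl ?block_mxEdr !mxE.
    - by rewrite !ord1 eqxx !mulr1n.
    - by rewrite eq_lrshift add0r.
    - by rewrite eq_rlshift add0r.
    - by rewrite (inj_eq (@rshift_inj _ _)).
  rewrite !mulmx_block !mul1mx !mul0mx !addr0 !mulmx1 !mulmx0 !add0r.
  congr block_mx; apply/matrixP => i j; rewrite !mxE ?big_ord_recl ?big_ord0.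
  - rewrite !ord1 eqxx (eq_bigr (fun=> 1)) => [|k _]; last first.
      by rewrite !mxE mulr1.
    by rewrite sumr_const card_ord -addrA -mulrS.
  - rewrite (eq_bigr (fun k => a *+ (i == k))) => [|k _]; last first.
      by rewrite !mxE big_ord_recl big_ord0 !mxE !mulr1 addr0 addrC addrK.
    rewrite (bigD1 i) //= eqxx big1 => [|k /negPf]; last first.
      by rewrite eq_sym => ->.
    by rewrite !mxE !ord1 eqxx !mulr1n; ring.
  - by rewrite !mxE mulr1 addr0 addrC addrK.
have <- : \det (L (- 1) *m A *m L 1) = \det A.
  by rewrite !det_mulmx !detL mul1r mulr1.
by rewrite LAL det_ublock !det_scalar expr1.
Qed.

Lemma reduced_signless_laplacian_complete (n : nat) :
  reduced_signless_laplacian (complete_graph n.+1) = n%:R%:M + const_mx 1.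
Proof.
apply/matrixP => i j; rewrite !mxE (inj_eq lift_inj) /= /complete_edges.
rewrite (inj_eq lift_inj); case: eqVneq => [->|_] /=; last by rewrite add0r.
(* Each vertex has degree [n + 1]: the scalar matrix supplies [n] and the all-ones matrix supplies
   1. *)
rewrite /deg (bigD1 (lift ord0 j)) //= /complete_edges eqxx add0n.
rewrite (eq_bigr (fun=> 1%N)) => [|k]; last by rewrite eq_sym => ->.
rewrite sum1_card cardC1 card_ord mulr1n.
by rewrite -[in LHS]addn1 PoszD natz.
Qed.

Lemma det_reduced_signless_laplacian_complete (n : nat) :
  \det (reduced_signless_laplacian (complete_graph n.+1))
    = (2 * n + 1)%:Z * n%:Z ^+ n.
Proof.
rewrite reduced_signless_laplacian_complete det_scalar_add_const1 -natrD !natz.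
by rewrite addnS mul2n addnn addn1.
Qed.

(** The first summand counts the functions that avoid [t]; the second chooses the one argument sent
    to [t], then values other than [t] elsewhere. For empty [A] the factor [#|A|] kills the term
    with the truncated exponent. *)
Lemma card_ffun_at_most_once (A T : finType) (t : T) :
  #|[set f : {ffun A -> T} |
      [forall i, forall j, (f i == t) && (f j == t) ==> (i == j)]]|
    = (#|T|.-1 ^ #|A| + #|A| * #|T|.-1 ^ #|A|.-1)%N.
Proof.
set B := [set f | _].
pose pos (f : {ffun A -> T}) := [pick i | f i == t].
have BP (f : {ffun A -> T}) :
    reflect (forall i j, f i = t -> f j = t -> i = j) (f \in B).
  rewrite inE; apply: (iffP 'forall_'forall_implyP) => [h i j fi fj | h i j].
    by apply/eqP/h; rewrite fi fj eqxx.
  by case/andP=> /eqP fi /eqP fj; apply/eqP/h.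
rewrite -sum1_card (partition_big pos predT) //=.
rewrite (bigD1 None) //= (reindex_omap Some id) /= => [|[]] //; congr addn.
  rewrite sum1_card -(cardC1 t) -card_ffun_on; apply: eq_card => f.
  rewrite [LHS]unfold_in /pos; case: pickP => [i fi | fn].
    by rewrite andbF; apply/esym/ffun_onP => /(_ i); rewrite inE fi.
  rewrite andbT; transitivity true; last first.
    by apply/esym/ffun_onP => i; rewrite inE fn.
  by apply/BP => i j /eqP; rewrite fn.
rewrite -[X in (X * _)%N]sum1_card big_distrl /=; apply: eq_big => [i|i _].
  by rewrite eqxx.
(* The fibre of [pos] over [Some i] is a product of independent choices: [t] at [i], anything else
   at the other arguments. *)
pose F j := if j == i then pred1 t else predC1 t.
rewrite mul1n sum1_card; transitivity #|(family F : {pred {ffun A -> T}})|.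
  apply: eq_card => f; rewrite [LHS]unfold_in.
  apply/andP/familyP => [[/BP fB] | fF].
    rewrite /pos; case: pickP => //= k /eqP fk /eqP [ki] j; rewrite /F -ki.
    case: eqVneq => [->|]; first by rewrite inE fk.
    by rewrite inE => /eqP jk; apply/eqP => fj; apply/jk/fB.
  have fE j : (f j == t) = (j == i).
    by move: (fF j); rewrite /F; case: eqVneq => _; rewrite inE // => /negPf.
  split.
    by apply/BP => j k /eqP; rewrite fE => /eqP -> /eqP; rewrite fE => /eqP.
  rewrite /pos; case: pickP => [k|/(_ i)]; first by rewrite fE => /eqP ->.
  by rewrite fE eqxx.
rewrite card_family foldrE big_image /= (bigD1 i) //= /F eqxx card1 mul1n.
rewrite (eq_bigr (fun=> #|T|.-1)) => [|j /negPf ->]; last exact: cardC1.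
by rewrite prod_nat_const cardC1.
Qed.

(** A multiple of ['X_[e s]] has only monomials divisible by it. If no generator divides ['X_[m]],
    comparing coefficients at [m] therefore gives [1 = 0]. *)
Lemma ideal_gen_mpolyX (K : fieldType) (n : nat) (I : finType) (P : pred I)
    (e : I -> 'X_{1..n}) (m : 'X_{1..n}) :
  ideal_gen P (fun s => 'X_[K, e s]) 'X_[K, m] <->
  exists2 s, P s & (e s <= m)%MM.
Proof.
split=> [[c Xm] | [s Ps le_sm]]; last first.
  exists (fun s' => if s' == s then 'X_[m - e s] else 0).
  rewrite (bigD1 s) //= eqxx -mpolyXD submK // big1 ?addr0 // => s'.
  by case/andP=> _ /negPf ->; rewrite mul0r.
have [/exists_inP // | /exists_inPn nle] :=
  boolP [exists s in P, (e s <= m)%MM].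
suff: (1 : K) = 0 by move/eqP; rewrite oner_eq0.
transitivity ('X_[K, m]@_m); first by rewrite mcoeffX eqxx.
rewrite Xm raddf_sum big1 // => s /nle nle_sm /=.
apply: memN_msupp_eq0; apply: contra nle_sm.
rewrite (perm_mem (msuppMX _ _)) => /mapP [m' _ ->].
exact: lem_addr.
Qed.

Definition m_sigma_exponent (n : nat) (s : {set 'I_n}) : 'X_{1..n} :=
  [multinom if i \in s then (n - #|s| + 1)%N else 0%N | i < n].

Lemma m_sigmaE (K : fieldType) (n : nat) (s : {set 'I_n}) :
  m_sigma K s = 'X_[m_sigma_exponent s].
Proof.
rewrite mpolyXE_id /m_sigma big_mkcond; apply: eq_bigr => i _.
by rewrite mnmE; case: (i \in s).
Qed.

Lemma m_sigma_exponent_le (n : nat) (s : {set 'I_n}) (m : 'X_{1..n}) :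
  reflect (forall i, i \in s -> n - #|s| < m i)%N (m_sigma_exponent s <= m)%MM.
Proof.
apply: (iffP mnm_lepP) => h i; have := h i; rewrite mnmE addn1.
  by move=> + si; rewrite si.
by case: (i \in s) => // ->.
Qed.

(** With [n.+1] variables, singletons give the generators [x_i^(n+1)], which bound each exponent by
    [n]; pairs give [x_i^n x_j^n], which forbid two exponents equal to [n]. *)
Lemma standard_monomialP (K : fieldType) (n : nat) (m : 'X_{1..n.+1}) :
  standard_monomial K m <->
  (forall i, m i <= n)%N /\ (forall i j, m i = n -> m j = n -> i = j).
Proof.
have in_M1E : in_M1 ('X_[K, m]) <->
    exists2 s : {set 'I_n.+1}, (1 <= #|s| <= 2)%N
      & forall i, i \in s -> (n.+1 - #|s| < m i)%N.
  have -> : in_M1 'X_[K, m] <->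
    ideal_gen (fun s : {set 'I_n.+1} => 1 <= #|s| <= 2)%N
      (fun s => 'X_[K, m_sigma_exponent s]) 'X_[K, m].
    by split=> -[c ->]; exists c; apply: eq_bigr => s _; rewrite m_sigmaE.
  by rewrite ideal_gen_mpolyX; split=> -[s Ps /m_sigma_exponent_le]; exists s.
rewrite /standard_monomial; split=> [std | [le_mn inj_mn] /in_M1E [s]].
  have le_mn i : (m i <= n)%N.
    rewrite leqNgt; apply/negP => gt_mi; apply/std/in_M1E.
    exists [set i]; rewrite ?cards1 // => j /set1P ->.
    by rewrite subn1.
  split=> // i j mi mj; apply/eqP; apply: contraT => ne_ij.
  case: std; apply/in_M1E; exists [set i; j]; rewrite cards2 ne_ij //.
  (* Two distinct indices exist, so [n] is positive; this makes [n.-1 < n] strict, as divisibility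
     by the generator of the pair requires. *)
  have n_gt0 : (0 < n)%N.
    rewrite lt0n; apply: contra ne_ij => /eqP n0.
    have val0 (k : 'I_n.+1) : k = 0%N :> nat.
      by apply/eqP; rewrite -leqn0 -[X in (_ <= X)%N]n0 leq_ord.
    by apply/eqP/val_inj; rewrite /= !val0.
  by move=> k /set2P [] ->; rewrite ?mi ?mj subSS subn1 ltn_predL.
case/andP; rewrite card_gt0 => /set0Pn [i si] card_s gt_m.
have [s1 | ns1] := eqVneq #|s| 1%N.
  by have := leq_trans (gt_m i si) (le_mn i); rewrite s1 subn1 ltnn.
have s2 : #|s| = 2.
  apply/eqP; rewrite eqn_leq card_s ltn_neqAle eq_sym ns1 card_gt0.
  by apply/set0Pn; exists i.
have/cards2P [j [k [ne_jk defs]]] : #|s| == 2 by rewrite s2.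
(* On a pair, the lower bound from divisibility meets the upper bound [n], so both exponents equal
   [n], against injectivity. *)
suff mn l : l \in s -> m l = n.
  by case/eqP: ne_jk; apply: inj_mn; apply: mn; rewrite defs !inE eqxx ?orbT.
move=> sl; apply/eqP; rewrite eqn_leq le_mn /=.
move: (gt_m l sl); rewrite s2 subSS subn1; exact: leq_trans (leqSpred _).
Qed.

Theorem proposition4p4 (K : fieldType) (n : nat) (hn : (1 <= n)%N) :
  exists stan : {fset 'X_{1..n}},
    [/\ forall m : 'X_{1..n}, m \in stan <-> standard_monomial K m,
        (#|` stan|)%:Z = \det (reduced_signless_laplacian (complete_graph n))
      & \det (reduced_signless_laplacian (complete_graph n))
          = (2 * n%:Z - 1) * (n%:Z - 1) ^+ (n - 1)].
Proof.
case: n hn => // n _.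
(* The domain indexes the variables; the codomain lists the admissible exponents 0 to [n], with
   [ord_max] the extreme one. *)
pose B := [set f : {ffun 'I_n.+1 -> 'I_n.+1} | [forall i, forall j,
  (f i == ord_max) && (f j == ord_max) ==> (i == j)]].
pose mon (f : {ffun 'I_n.+1 -> 'I_n.+1}) : 'X_{1..n.+1} :=
  [multinom (f i : nat) | i < n.+1].
have mon_inj : injective mon.
  move=> f g /mnmP eq_fg; apply/ffunP => i; apply: val_inj.
  by have := eq_fg i; rewrite !mnmE.
rewrite det_reduced_signless_laplacian_complete.
exists [fset mon f | f in B]%fset; split.
- move=> m; rewrite standard_monomialP; split.
    case/imfsetP => f /=; rewrite inE => /'forall_'forall_implyP fB ->.
    split=> [i | i j]; rewrite !mnmE; first exact: leq_ord.
    by move=> fi fj; apply/eqP/fB; rewrite -!val_eqE /= fi fj eqxx.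
  (* The bound [le_mn] ensures that [inord] never returns its default value. *)
  case=> le_mn inj_mn; apply/imfsetP; exists [ffun i => inord (m i)] => /=.
    rewrite inE; apply/'forall_'forall_implyP => i j.
    rewrite !ffunE -!(val_eqE (inord _)) /=.
    by rewrite !inordK ?ltnS // => /andP [/eqP mi /eqP mj]; apply/eqP/inj_mn.
  by apply/mnmP => i; rewrite mnmE ffunE inordK ?ltnS.
(* The count is [n^(n+1) + (n+1) n^n = (2n+1) n^n]. *)
- rewrite card_imfset //= -cardE card_ffun_at_most_once card_ord /=.
  rewrite -[n%:Z]natz -natrX natz -PoszM; congr Posz.
  by rewrite expnS -mulnDl addnS mul2n addnn addn1.
(* After the shift of [n] only [2n+1 = 2(n+1)-1] remains; for [n = 0] the power is [0 ^+ 0 = 1],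
   matching the convention. *)
- rewrite subn1 /=.
  have -> : n.+1%:Z - 1 = n%:Z by rewrite intS addrC addKr.
  by congr (_ * _); rewrite PoszD PoszM intS; ring.
Qed.
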